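(* There is a constant $c>0$ such that every two-dimensional torus graph $G$ with $n$ vertices satisfies $\widetilde{\mathsf{VC}}(G)\ge c\,n^{3/2}$.
   Context: The two-dimensional torus with $n$ vertices is the $\sqrt n\times\sqrt n$ grid with wrap-around edges (Cartesian product of two cycles of length $\sqrt n$). Unweighted deterministic walk: each vertex $u$ has a rotor sequence of length $\tilde d(u)$ of neighbours of $u$, each occurring exactly $\tilde d(u)/\deg(u)$ times, and an initial rotor position; the walk moves from the current vertex to the vertex its rotor points at and then advances that rotor cyclically. $\widetilde{\mathsf{VC}}(G)$ is the maximum over start vertices and all rotor sequences/initial positions (lengths fixed) of the least $t$ by which all vertices have been visited. *)

(* Defs.v *)
From HB Require Import structures.
From mathcomp Require Import all_boot all_order all_algebra.
From mathcomp Require Import all_classical all_reals all_analysis.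

Set Implicit Arguments.
Unset Strict Implicit.
Unset Printing Implicit Defensive.

(* A finite simple graph is an adjacency relation [e : rel V] on a finite
   type of vertices. *)

Definition deg (V : finType) (e : rel V) (u : V) : nat := #|[pred v | e u v]|.

Definition cycle_graph (m : nat) : rel 'I_m :=
  fun i j => (j == ordS i) || (i == ordS j).

Definition cartesian_product (V W : finType) (e : rel V) (f : rel W) :
    rel (V * W) :=
  fun x y => ((x.1 == y.1) && f x.2 y.2) || (e x.1 y.1 && (x.2 == y.2)).

Definition torus (m : nat) : rel ('I_m * 'I_m) :=
  cartesian_product (@cycle_graph m) (@cycle_graph m).

Section DeterministicWalk.
Variables (V : finType) (e : rel V) (dt : V -> nat).

Definition rotor_lengths : Prop :=
  forall u, (0 < dt u)%N && (deg e u %| dt u)%N.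

Definition rotor_seqs := {dffun forall u : V, (dt u).-tuple V}.
Definition rotor_positions := {dffun forall u : V, 'I_(dt u)}.

Definition valid_rotor_seqs (s : rotor_seqs) : bool :=
  [forall u, forall v,
    count_mem v (s u) == if e u v then (dt u %/ deg e u)%N else 0%N].

Definition walk_step (s : rotor_seqs) (c : V * rotor_positions) :
    V * rotor_positions :=
  (tnth (s c.1) (c.2 c.1),
   [ffun u : V => if u == c.1 then ordS (c.2 u) else c.2 u]).

Definition walk (s : rotor_seqs) (x : V) (r : rotor_positions) (t : nat) : V :=
  (iter t (walk_step s) (x, r)).1.

Definition covered_by (s : rotor_seqs) (x : V) (r : rotor_positions)
    (t : nat) : bool :=
  [forall v : V, exists k : 'I_t.+1, walk s x r k == v].

(* On a connected graph with valid rotor sequences every walk covers the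
   graph, so the second branch is never taken; its value 0 cannot help a
   lower bound on [VC]. *)
Definition cover_time (s : rotor_seqs) (x : V) (r : rotor_positions) : nat :=
  if pselect (exists t, covered_by s x r t) is left H then ex_minn H else 0%N.

Definition VC : nat :=
  \max_(x : V) \max_(s : rotor_seqs | valid_rotor_seqs s)
    \max_(r : rotor_positions) cover_time s x r.

End DeterministicWalk.

(* Main.v *)
Require Import Defs.
From HB Require Import structures.
From mathcomp Require Import all_boot all_order all_algebra.
From mathcomp Require Import all_classical all_reals all_analysis.
From mathcomp Require Import zify.
Import Order.TTheory GRing.Theory Num.Theory.
Local Open Scope ring_scope.

(* Let every vertex serve its neighbours closer to the start [x0] before the
   others.  For a distance function [d] to [x0], consider the odometer
     f v = \sum_(w ~ v) (i - min (d v) (d w))   (truncated subtraction).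
   Under this rotor order, [f v] exits from [v] use the arc from [v] to [w]
   exactly [i - min (d v) (d w)] times, which is symmetric in [v] and [w], so
   [f] is a circulation.  By flow conservation the walk can only exceed [f] for
   the first time at [x0].  At that moment its exit counts are exactly [f]: the
   last arc used at [v <> x0] leads closer to [x0], so a deficit at [v] would
   propagate along these last arcs down to [x0], where there is none.  Since [f]
   vanishes on vertices at distance more than [i], such vertices are reached
   only after time [\sum_v f v]; on the torus, with [i] close to the diameter,
   this sum has order [m ^ 3].  Taking [i] large instead shows that the walk
   covers the graph at all, so that [cover_time] is not the junk value [0]. *)

(** * Odometers of a deterministic walk *)

Section Odometer.
Set Implicit Arguments.
Unset Strict Implicit.
Local Open Scope nat_scope.
Variables (V : finType) (nxt : V -> nat -> V) (X : nat -> V).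

Definition exits (t : nat) (v : V) : nat := \sum_(k < t) (X k == v).

Definition arc_uses (u w : V) (k : nat) : nat := \sum_(j < k) (nxt u j == w).

Hypothesis X_succ : forall t, X t.+1 = nxt (X t) (exits t (X t)).

Lemma exitsS t v : exits t.+1 v = exits t v + (X t == v).
Proof. by rewrite /exits big_ord_recr. Qed.

Lemma arc_usesS u w k : arc_uses u w k.+1 = arc_uses u w k + (nxt u k == w).
Proof. by rewrite /arc_uses big_ord_recr. Qed.

Lemma leq_arc_uses u w k l : k <= l -> arc_uses u w k <= arc_uses u w l.
Proof.
move=> /subnKC <-; elim: (l - k) => [|n IHn]; first by rewrite addn0.
by rewrite addnS arc_usesS (leq_trans IHn) ?leq_addr.
Qed.

Lemma exits_gt0 t v : 0 < exits t v -> exists2 k, k < t & X k = v.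
Proof.
elim: t => [|t IHt]; first by rewrite /exits big_ord0.
rewrite exitsS; case: (eqVneq (X t) v) => [Xt _|_]; first by exists t.
by rewrite addn0 => /IHt [k kt Xk]; exists k => //; apply: ltnW.
Qed.

Lemma sum_exits t : \sum_v exits t v = t.
Proof.
elim: t => [|t IHt].
  by rewrite big1 // => v _; rewrite /exits big_ord0.
under eq_bigr do rewrite exitsS.
rewrite big_split /= IHt (bigD1 (X t)) //= eqxx big1 ?addn0 ?addn1 //.
by move=> v; rewrite eq_sym => /negPf ->.
Qed.

(** Conservation at [w]: arrivals plus the initial presence equal departures plus the current
    presence, since both sides count the visits to [w] up to time [t]. *)
Lemma inflow t w :
  \sum_u arc_uses u w (exits t u) + (X 0 == w) = exits t w + (X t == w).
Proof.
elim: t => [|t IHt].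
  have exits0 u : exits 0 u = 0 by rewrite /exits big_ord0.
  rewrite big1 ?exits0 // => u _.
  by rewrite exits0 /arc_uses big_ord0.
have -> : \sum_u arc_uses u w (exits t.+1 u) =
    \sum_u arc_uses u w (exits t u) + (X t.+1 == w).
  rewrite (bigD1 (X t)) //= [in RHS](bigD1 (X t)) //= exitsS eqxx addn1.
  rewrite arc_usesS -X_succ -!addnA; congr (_ + _); rewrite addnC.
  congr (_ + _); apply: eq_bigr => u; rewrite eq_sym exitsS => /negPf ->.
  by rewrite addn0.
by rewrite addnAC IHt exitsS.
Qed.

Variables (f : V -> nat) (d : V -> nat).
Hypothesis f_flow : forall w, \sum_u arc_uses u w (f u) = f w.
Hypothesis f_last : forall v,
  v != X 0 -> 0 < f v -> d (nxt v (f v).-1) < d v.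

Lemma inflow_le t w :
  (forall v, exits t v <= f v) -> \sum_u arc_uses u w (exits t u) <= f w.
Proof. by move=> le_f; rewrite -f_flow leq_sum // => u _; apply: leq_arc_uses. Qed.

(* The inflow into [X t] exceeds its outflow by one unless [X t = X 0]; the
   exit counts then form a circulation, and deficits descend along [d]. *)
Lemma exits_saturated t :
  (forall v, exits t v <= f v) -> exits t (X t) = f (X t) -> exits t =1 f.
Proof.
move=> le_f sat.
have Xt0 : X t = X 0.
  have := inflow t (X t); have := inflow_le (X t) le_f.
  by rewrite sat eqxx; case: eqP => // _; lia.
have flow w : \sum_u arc_uses u w (exits t u) = exits t w.
  by have := inflow t w; rewrite Xt0; lia.
move=> v; have [n] := ubnP (d v); elim: n v => // n IHn v dv.
apply/eqP; rewrite eqn_leq le_f leqNgt; apply/negP => lt_f.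
have v0 : v != X 0 by apply: contraTneq lt_f => ->; rewrite -Xt0 sat ltnn.
have fv : 0 < f v by apply: leq_ltn_trans lt_f.
have dw := f_last v0 fv; set w := nxt v _ in dw.
have := IHn w (leq_trans dw dv); apply/eqP; rewrite ltn_eqF //.
rewrite -flow -[f w]f_flow (bigD1 v) //= [ltnRHS](bigD1 v) //= -addSn.
apply: leq_add; last by apply: leq_sum => u _; apply: leq_arc_uses.
rewrite -[in ltnRHS](prednK fv) arc_usesS eqxx addn1 ltnS.
by apply: leq_arc_uses; rewrite -ltnS (prednK fv).
Qed.

Lemma odometer_exact t v :
  f v < exits t v -> \sum_u f u < t /\ exits (\sum_u f u) =1 f.
Proof.
move=> bad.
have exP : exists t, [exists v, f v < exits t v].
  by exists t; apply/existsP; exists v.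
case: (ex_minnP exP) => [[|s]] /existsP [u lt_u] min_s.
  by move: lt_u; rewrite /exits big_ord0.
have le_f w : exits s w <= f w.
  rewrite leqNgt; apply/negP => lt_w.
  suff: s.+1 <= s by rewrite ltnn.
  by apply: min_s; apply/existsP; exists w.
(* Only the count of [X s] grows at this step, so the first vertex to exceed [f] is [X s], and it
   was saturated just before. *)
have : exits s (X s) = f (X s).
  move: lt_u; rewrite exitsS; have := le_f u.
  by case: eqP => [<-|_]; lia.
move=> /(exits_saturated le_f) sat.
have -> : \sum_u f u = s.
  by rewrite -[RHS]sum_exits; apply: eq_bigr => w _; rewrite sat.
by split=> //; apply: min_s; apply/existsP; exists v.
Qed.

(** As long as no exit count exceeds [f], the inflow into [z] is at most [f z = 0], whereas standing
    at [z] requires an arrival. *)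
Lemma odometer_before_visit t z :
  z != X 0 -> f z = 0 -> X t = z -> \sum_u f u < t.
Proof.
move=> z0 fz Xt.
case: (boolP [exists v, f v < exits t v]) => [/existsP[v]|].
  by case/odometer_exact.
rewrite negb_exists => /forallP le_f.
have le v : exits t v <= f v by rewrite leqNgt.
have := inflow t z; have := inflow_le z le; rewrite eq_sym (negPf z0) Xt eqxx fz.
lia.
Qed.

(** By pigeonhole, one step beyond the total of [f] some exit count exceeds [f]; hence at that total
    every [v] has been left exactly [f v > 0] times. *)
Lemma odometer_covers :
  (forall v, 0 < f v) -> forall v, exists2 k, k < \sum_u f u & X k = v.
Proof.
move=> f_gt0 v.
have [u lt_u] : exists u, f u < exits (\sum_u f u).+1 u.
  apply/existsP; rewrite -[X in is_true X]negbK negb_exists.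
  apply/negP => /forallP le.
  have : \sum_u exits (\sum_u f u).+1 u <= \sum_u f u.
    by apply: leq_sum => u _; rewrite leqNgt.
  by rewrite sum_exits ltnn.
by have [_ sat] := odometer_exact lt_u; apply: exits_gt0; rewrite sat.
Qed.

End Odometer.

(** * Rotors serving closer neighbours first, and their odometer *)

Section SortedRotors.
Set Implicit Arguments.
Unset Strict Implicit.
Local Open Scope nat_scope.
Variables (V : finType) (e : rel V) (d : V -> nat).

Definition parents (v : V) : seq V := enum [pred w | e v w && (d w < d v)].

Definition rotor_cycle (v : V) : seq V :=
  parents v ++ enum [pred w | e v w && (d v <= d w)].

Definition rotor_target (v : V) (j : nat) : V :=
  nth v (rotor_cycle v) (j %% deg e v).

Lemma mem_parents v w : (w \in parents v) = e v w && (d w < d v).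
Proof. by rewrite mem_enum. Qed.

Lemma mem_rotor_cycle v w : (w \in rotor_cycle v) = e v w.
Proof.
by rewrite mem_cat !mem_enum !inE -andb_orr [d v <= d w]leqNgt orbN andbT.
Qed.

Lemma uniq_rotor_cycle v : uniq (rotor_cycle v).
Proof.
rewrite cat_uniq !enum_uniq andbT /=; apply/hasPn => w.
by rewrite mem_parents mem_enum inE => /andP[-> ?]; rewrite -leqNgt.
Qed.

Lemma size_rotor_cycle v : size (rotor_cycle v) = deg e v.
Proof.
rewrite -(card_uniqP (uniq_rotor_cycle v)); apply: eq_card => w.
by rewrite mem_rotor_cycle.
Qed.

Lemma size_parents v : size (parents v) <= deg e v.
Proof. by rewrite -size_rotor_cycle size_cat leq_addr. Qed.

Lemma sum_nth_mem (s : seq V) x0 w r : uniq s -> r <= size s ->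
  \sum_(j < r) (nth x0 s j == w) = (w \in take r s).
Proof.
move=> us rs; rewrite -(count_uniq_mem w (take_uniq r us)).
have -> : take r s = [seq nth x0 s j | j <- iota 0 r].
  by rewrite map_nth_iota0.
rewrite count_map -sum1_count [RHS]big_mkcond /=.
rewrite -(big_mkord xpredT (fun j => nat_of_bool (nth x0 s j == w))).
by rewrite /index_iota subn0; apply: eq_bigr => j _ /=; case: eqP.
Qed.

(** Each of the [q] full turns uses every arc out of [u] once; the partial turn uses the first [r]
    entries of the cycle. *)
Lemma arc_uses_rotor u w q r : r <= deg e u ->
  arc_uses rotor_target u w (q * deg e u + r) =
    q * e u w + (w \in take r (rotor_cycle u)).
Proof.
move=> rdeg; have block n s : s <= deg e u ->
    \sum_(j < s) (rotor_target u (n * deg e u + j) == w) =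
    (w \in take s (rotor_cycle u)).
  move=> sdeg; rewrite -(sum_nth_mem u w (uniq_rotor_cycle u)) ?size_rotor_cycle //.
  case: s sdeg => [|s] sdeg; first by rewrite !big_ord0.
  apply: eq_bigr => j _; rewrite /rotor_target modnMDl modn_small //.
  exact: leq_trans sdeg.
rewrite /arc_uses big_split_ord /= block //; congr (_ + _).
elim: q => [|q IHq]; first by rewrite mul0n big_ord0.
rewrite mulSnr big_split_ord /= IHq block // -size_rotor_cycle take_size.
by rewrite mem_rotor_cycle mulSnr.
Qed.

Definition ball_odometer (i : nat) (v : V) : nat :=
  \sum_(w | e v w) (i - minn (d v) (d w)).

Hypothesis e_sym : symmetric e.
Hypothesis d_lip : forall u v, e u v -> d u <= (d v).+1.

(** By [d_lip] a closer neighbour has distance exactly [d v - 1], so it contributes one more than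
    [i - d v]. The odometer thus consists of [i - d v] full turns followed by one exit to each
    parent. *)
Lemma ball_odometerE i v : d v <= i ->
  ball_odometer i v = (i - d v) * deg e v + size (parents v).
Proof.
move=> dvi; have -> : size (parents v) = \sum_(w | e v w) (d w < d v).
  by rewrite -cardE -sum1_card big_mkcondr.
rewrite /deg -sum1_card big_distrr -big_split /=; apply: eq_bigr => w evw.
by have := d_lip evw; rewrite muln1; case: ltnP; lia.
Qed.

Lemma ball_odometer0 i v : i < d v -> ball_odometer i v = 0.
Proof.
by move=> idv; apply: big1 => w evw; have := d_lip evw; lia.
Qed.

Lemma arc_uses_ball_odometer i u w :
  arc_uses rotor_target u w (ball_odometer i u) =
    if e u w then i - minn (d u) (d w) else 0.
Proof.
have [dui|idu] := leqP (d u) i.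
  rewrite ball_odometerE // arc_uses_rotor ?size_parents //.
  rewrite take_size_cat // mem_parents; case: (boolP (e u w)) => [euw|_].
    by have := d_lip euw; rewrite muln1 /=; case: ltnP; lia.
  by rewrite muln0.
rewrite ball_odometer0 // /arc_uses big_ord0.
by case: ifP => // /d_lip; lia.
Qed.

Lemma ball_odometer_flow i w :
  \sum_u arc_uses rotor_target u w (ball_odometer i u) = ball_odometer i w.
Proof.
under eq_bigr do rewrite arc_uses_ball_odometer.
rewrite -big_mkcond /=; apply: eq_big => u; first by rewrite e_sym.
by rewrite minnC.
Qed.

Lemma ball_odometer_last i v :
  0 < size (parents v) -> 0 < ball_odometer i v ->
  d (rotor_target v (ball_odometer i v).-1) < d v.
Proof.
move=> p_gt0 odo_gt0; have [dvi|/ball_odometer0 E] := leqP (d v) i; last first.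
  by rewrite E in odo_gt0.
have lt_p : (size (parents v)).-1 < size (parents v) by rewrite prednK.
(* Modulo the full turns, the last exit has index [(size (parents v)).-1], which falls in the block
   of parents. *)
rewrite ball_odometerE // -subn1 -addnBA // subn1 /rotor_target modnMDl.
rewrite modn_small ?(leq_trans lt_p) ?size_parents // nth_cat lt_p.
by have /(mem_nth v) := lt_p; rewrite mem_parents => /andP[].
Qed.

End SortedRotors.

(** * From odometers to a lower bound on the cover time *)

Section CoverTime.
Set Implicit Arguments.
Unset Strict Implicit.
Local Open Scope nat_scope.
Variables (V : finType) (e : rel V) (dt : V -> nat) (d : V -> nat) (x0 : V).
Hypothesis dt_deg : rotor_lengths e dt.
Hypothesis e_sym : symmetric e.
Hypothesis d_lip : forall u v, e u v -> d u <= (d v).+1.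
Hypothesis d_parent : forall v, v != x0 -> exists2 w, e v w & d w < d v.

Definition sorted_rotors : rotor_seqs dt :=
  [ffun u => [tuple rotor_target e d u j | j < dt u]].

Definition zero_positions : rotor_positions dt :=
  [ffun u => Ordinal (proj1 (andP (dt_deg u)))].

Lemma deg_gt0 u : 0 < deg e u.
Proof. by have /andP[dt0 /dvdn_gt0 ->] := dt_deg u. Qed.

Lemma sorted_rotors_valid : valid_rotor_seqs e sorted_rotors.
Proof.
apply/forallP => u; apply/forallP => v; rewrite ffunE; apply/eqP.
have -> : count_mem v [tuple rotor_target e d u j | j < dt u] =
    arc_uses (rotor_target e d) u v (dt u).
  by rewrite /= count_map -sum1_count big_mkcond big_enum.
have /andP[_ dvd_deg] := dt_deg u; rewrite -{1}(divnK dvd_deg) -[_ * _]addn0.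
rewrite arc_uses_rotor // take0 in_nil addn0.
by case: (e u v); rewrite ?muln1 ?muln0.
Qed.

Let X := walk sorted_rotors x0 zero_positions.

Lemma walk_positions t u :
  (iter t (walk_step sorted_rotors) (x0, zero_positions)).2 u =
    exits X t u %% dt u :> nat.
Proof.
elim: t => [|t IHt]; first by rewrite ffunE /exits big_ord0 mod0n.
rewrite iterS ffunE exitsS /= -/(walk _ _ _ t) -/(X t) [X t == u]eq_sym.
case: eqP => _ /=; last by rewrite addn0.
by rewrite IHt -addn1 modnDml.
Qed.

(** Rotor positions live modulo [dt], targets modulo the degree; they agree because the degree
    divides [dt]. *)
Lemma walkS t : X t.+1 = rotor_target e d (X t) (exits X t (X t)).
Proof.
rewrite [LHS]/= {1}/X /walk iterS /= -/(walk _ _ _ t) -/(X t) ffunE tnth_mktuple.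
rewrite walk_positions /rotor_target; congr nth.
by have /andP[_ dvd_deg] := dt_deg (X t); rewrite modn_dvdm.
Qed.

Lemma last_exit i v : v != X 0 -> 0 < ball_odometer e d i v ->
  d (rotor_target e d v (ball_odometer e d i v).-1) < d v.
Proof.
move=> /d_parent [w evw dwv]; apply: ball_odometer_last => //.
have : w \in parents e d v by rewrite mem_parents evw.
by case: (parents e d v).
Qed.

Lemma walk_covers : exists t, Defs.covered_by sorted_rotors x0 zero_positions t.
Proof.
(* A radius beyond all distances makes the odometer positive everywhere. *)
pose i := (\max_v d v).+1.
have dvi v : d v < i by rewrite ltnS leq_bigmax.
have f_gt0 v : 0 < ball_odometer e d i v.
  rewrite ball_odometerE ?(ltnW (dvi v)) // addn_gt0 muln_gt0 deg_gt0.
  by rewrite subn_gt0 dvi.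
exists (\sum_v ball_odometer e d i v); apply/forallP => v; apply/existsP.
have [k lt_k Xk] := odometer_covers walkS (ball_odometer_flow e_sym d_lip i)
  (@last_exit i) f_gt0 v.
by exists (Ordinal (leqW lt_k)); apply/eqP.
Qed.

Lemma VC_gt_odometer i z :
  z != x0 -> i < d z -> \sum_v ball_odometer e d i v < VC e dt.
Proof.
move=> zx0 idz.
apply: (@leq_trans (cover_time sorted_rotors x0 zero_positions)); last first.
  rewrite /VC; apply: leq_trans (leq_bigmax x0).
  apply: leq_trans (leq_bigmax_cond _ sorted_rotors_valid).
  exact: leq_bigmax zero_positions.
rewrite /cover_time; case: pselect => [H|/(_ walk_covers)] //.
case: ex_minnP => t /forallP /(_ z) /existsP [k /eqP Xk] _.
rewrite -ltnS (leq_trans _ (ltn_ord k)) // ltnS.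
apply: (odometer_before_visit walkS (ball_odometer_flow e_sym d_lip i)
  (@last_exit i)) Xk => //.
exact: ball_odometer0.
Qed.

(** The radius [(d z).-1] is the largest for which the odometer is known to vanish at [z]. Dropping
    the parents and bounding degrees below by 1 leaves a plain sum of distances. *)
Lemma VC_gt_ball_sum z :
  z != x0 -> 0 < d z -> \sum_v ((d z).-1 - d v) < VC e dt.
Proof.
move=> zx0 dz; apply: leq_ltn_trans (VC_gt_odometer zx0 (i := (d z).-1) _); last first.
  by rewrite prednK.
apply: leq_sum => v _; have [le_d|/ltnW] := leqP (d v) (d z).-1; last first.
  by rewrite -subn_eq0 => /eqP ->.
by rewrite ball_odometerE // -[leqLHS]addn0 leq_add // leq_pmulr ?deg_gt0.
Qed.

End CoverTime.

(** * Distances on the torus and the cubic bound *)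

Section Torus.
Set Implicit Arguments.
Unset Strict Implicit.
Local Open Scope nat_scope.
Variable m : nat.

(** Graph distance from 0 to [i] on the cycle, taking the shorter way round. *)
Definition cycle_norm (i : 'I_m) : nat := minn i (m - i).

Definition torus_norm (p : 'I_m * 'I_m) : nat := cycle_norm p.1 + cycle_norm p.2.

Lemma val_ordS (i : 'I_m) : ordS i = (if i.+1 == m then 0 else i.+1) :> nat.
Proof.
have im := ltn_ord i; case: eqP => [E|nE] /=; first by rewrite E modnn.
by rewrite modn_small //; lia.
Qed.

Lemma cycle_norm_lip (i j : 'I_m) :
  cycle_graph i j -> cycle_norm i <= (cycle_norm j).+1.
Proof.
rewrite /cycle_norm /cycle_graph; have := ltn_ord i; have := ltn_ord j => jm im.
by case/orP => /eqP ->; rewrite val_ordS; case: eqP; lia.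
Qed.

Lemma cycle_norm_parent (i : 'I_m) :
  0 < cycle_norm i -> exists2 j, cycle_graph i j & cycle_norm j < cycle_norm i.
Proof.
have im := ltn_ord i; rewrite /cycle_norm => i_gt0.
have [le_i|gt_i] := leqP i (m - i); last first.
  exists (ordS i); first by rewrite /cycle_graph eqxx.
  by rewrite val_ordS; case: eqP; lia.
have lt_pred : i.-1 < m by lia.
exists (Ordinal lt_pred); last by rewrite /=; lia.
rewrite /cycle_graph; apply/orP; right; apply/eqP/val_inj; rewrite [RHS]val_ordS /=.
by case: eqP; lia.
Qed.

Lemma torus_sym : symmetric (@torus m).
Proof.
have sym : symmetric (@cycle_graph m) by move=> i j; rewrite /cycle_graph orbC.
move=> p q; rewrite /torus /cartesian_product sym [cycle_graph p.1 _]sym.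
by rewrite [p.1 == _]eq_sym [p.2 == _]eq_sym.
Qed.

Lemma torus_norm_lip p q : torus p q -> torus_norm p <= (torus_norm q).+1.
Proof.
rewrite /torus_norm /torus /cartesian_product.
case/orP => /andP[]; first by move=> /eqP -> /cycle_norm_lip; rewrite -addnS leq_add2l.
by move=> /cycle_norm_lip + /eqP ->; rewrite -addSn leq_add2r.
Qed.

Lemma torus_norm_parent p :
  0 < torus_norm p -> exists2 q, torus p q & torus_norm q < torus_norm p.
Proof.
case: p => x y; rewrite /torus_norm /= addn_gt0.
case/orP => /cycle_norm_parent [w ew lt_w].
  exists (w, y); first by rewrite /torus /cartesian_product /= ew eqxx orbT.
  by rewrite /= ltn_add2r.
exists (x, w); first by rewrite /torus /cartesian_product /= ew eqxx.
by rewrite /= ltn_add2l.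
Qed.

Lemma sum_box (q h : nat) (F : 'I_m * 'I_m -> nat) : q <= m ->
  (forall x y : 'I_m, x < q -> y < q -> h <= F (x, y)) ->
  q * (q * h) <= \sum_p F p.
Proof.
move=> qm hF; have -> : \sum_p F p = \sum_x \sum_y F (x, y).
  by rewrite pair_bigA; apply: eq_bigr => -[].
have -> : q * (q * h) = \sum_(x < m | x < q) \sum_(y < m | y < q) h.
  by rewrite !(big_ord_narrow qm) /= !sum_nat_const !card_ord.
rewrite big_mkcond; apply: leq_sum => x _; case: ifP => // xq.
rewrite big_mkcond; apply: leq_sum => y _; case: ifP => // yq.
exact: hF.
Qed.

Lemma VC_torus (dt : 'I_m * 'I_m -> nat) :
  3 <= m -> rotor_lengths (@torus m) dt -> m ^ 3 <= 128 * VC (@torus m) dt.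
Proof.
move=> m3 dt_deg; have m_gt0 : 0 < m by lia.
have half : m %/ 2 < m by lia.
pose o := Ordinal m_gt0; pose x0 := (o, o).
pose a := Ordinal half; pose z := (a, a).
have norm_gt0 p : p != x0 -> 0 < torus_norm p.
  case: p => x y; rewrite /torus_norm /cycle_norm /=; apply: contraNT.
  have := ltn_ord x; have := ltn_ord y => ltx lty le0.
  by rewrite xpair_eqE -!val_eqE /=; lia.
have dz : torus_norm z = 2 * (m %/ 2) by rewrite /torus_norm /cycle_norm /=; lia.
have zx0 : z != x0 by rewrite xpair_eqE -!val_eqE /=; lia.
have := @VC_gt_ball_sum _ _ dt torus_norm x0 dt_deg torus_sym torus_norm_lip
  (fun p px0 => torus_norm_parent (norm_gt0 p px0)) z zx0 (norm_gt0 z zx0).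
(* [z] is a vertex farthest from [x0]. Only the box of coordinates at most [m %/ 4] is kept: norms
   there are at most [2 * (m %/ 4)], so each term is at least [h]. With [q >= m / 4] and
   [h >= m / 8], the constant is 4 * 4 * 8 = 128. *)
rewrite dz => lt_VC; pose q := (m %/ 4).+1.
pose h := 2 * (m %/ 2) - 1 - 2 * (m %/ 4).
have qm : q <= m by rewrite /q; lia.
have : q * (q * h) <= VC (@torus m) dt.
  apply: leq_trans (ltnW lt_VC); apply: sum_box => // x y.
  rewrite /torus_norm /cycle_norm /q /h /=; lia.
have q4 : m <= 4 * q by rewrite /q; lia.
have h8 : m <= 8 * h by rewrite /h; lia.
have : m * (m * m) <= (4 * q) * ((4 * q) * (8 * h)) by rewrite !leq_mul.
rewrite !expnS expn0 muln1; lia.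
Qed.

End Torus.

Theorem theorem4p7 (R : realType) :
  exists2 c : R, 0 < c &
    forall (m : nat) (dt : 'I_m * 'I_m -> nat),
      (3 <= m)%N ->
      rotor_lengths (@torus m) dt ->
      c * #|{: 'I_m * 'I_m}|%:R `^ (3 / 2) <= (VC (@torus m) dt)%:R.
Proof.
exists 128^-1 => [|m dt m3 dt_deg]; first by rewrite invr_gt0 ltr0n.
rewrite mulrC ler_pdivrMr ?ltr0n // card_prod card_ord natrM -expr2.
(* There are [m ^ 2] vertices, and raising this to the power 3/2 gives [m ^ 3]. *)
rewrite -powR_mulrn ?ler0n // -powRrM mulrC divfK ?pnatr_eq0 //.
by rewrite powR_mulrn ?ler0n // -natrX mulrC -natrM ler_nat VC_torus.
Qed.
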